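(* Let $k\ge1$ be an integer and let $I\subset S=K[x_1,\ldots,x_n]$ ($K$ a field) be a $k$-Borel ideal generated in a single degree. Choose any order $u_1,\ldots,u_m$ of the elements of $G(I)$ which extends the partial order $\prec_k$, i.e. if $u_i\prec_k u_j$ then $i<j$. Then $I$ has linear quotients with respect to this order of the generators.
   Context: For a monomial ideal $I$, $G(I)$ is its unique minimal set of monomial generators; $\operatorname{supp}(u)=\{i: x_i\mid u\}$. A monomial $u=x_1^{a_1}\cdots x_n^{a_n}$ is $k$-bounded if $a_i\le k$ for all $i$; a monomial ideal is $k$-bounded if it is generated by $k$-bounded monomials. A $k$-bounded monomial ideal $I$ is $k$-Borel if for every $k$-bounded monomial $u\in I$, every $j\in\operatorname{supp}(u)$ and every $i<j$ one has $x_i(u/x_j)\in I$, provided $x_i(u/x_j)$ is $k$-bounded. $B_k(u)$ is the smallest $k$-Borel ideal containing the $k$-bounded monomial $u$. For $k$-bounded monomials $u,v$ of the same degree, $v\preceq_k u$ means $v\in B_k(u)$; this is a partial order, and $v\prec_k u$ means $v\preceq_k u$ and $v\ne u$. A monomial ideal $I$ with $G(I)=\{u_1,\ldots,u_m\}$ has linear quotients with respect to the order $u_1,\ldots,u_m$ if for every $2\le j\le m$ the colon ideal $(u_1,\ldots,u_{j-1}):(u_j)$ is generated by a subset of the variables. *)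

(* Defs.v *)
From HB Require Import structures.
From mathcomp Require Export all_boot all_order all_algebra.
From mathcomp.multinomials Require Export mpoly.

Set Implicit Arguments.
Unset Strict Implicit.
Unset Printing Implicit Defensive.

Import GRing.Theory.
Local Open Scope ring_scope.

(* Subsets of S = K[x_1, ..., x_n], in particular ideals, are Prop-valued
   predicates on {mpoly K[n]}.  Monomials are exponent vectors u : 'X_{1..n},
   viewed in S as 'X_[K, u]; sets of monomials are predicates on 'X_{1..n}. *)

Section Ideals.
Variables (K : fieldType) (n : nat).
Implicit Types (I J : {mpoly K[n]} -> Prop) (A : 'X_{1..n} -> Prop).

Definition is_ideal I : Prop :=
  [/\ I 0,
      forall p q, I p -> I q -> I (p + q)
    & forall a p, I p -> I (a * p)].

Definition ideal_span (P : {mpoly K[n]} -> Prop) : {mpoly K[n]} -> Prop :=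
  fun p => forall J, is_ideal J -> (forall q, P q -> J q) -> J p.

Definition colon I J : {mpoly K[n]} -> Prop :=
  fun p => forall q, J q -> I (p * q).

Definition monomial_span A : {mpoly K[n]} -> Prop :=
  ideal_span (fun p => exists2 u, A u & p = 'X_[K, u]).

Definition generated_by I A : Prop := forall p, I p <-> monomial_span A p.

(* A is G(I): a monomial generating set of I no proper subset of which
   generates I. *)
Definition minimal_generators I A : Prop :=
  generated_by I A /\
  forall A', (forall u, A' u -> A u) -> generated_by I A' ->
    forall u, A u -> A' u.

Definition generated_in_single_degree I : Prop :=
  exists d A, (forall u, A u -> mdeg u = d) /\ generated_by I A.

(* u_0, ..., u_(m-1) lists the elements of G(I) without repetition. *)
Definition enumerates_generators I (m : nat) (u : 'I_m -> 'X_{1..n}) : Prop :=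
  injective u /\ minimal_generators I (fun v => exists i, v = u i).

End Ideals.

(* The colon condition starts at the second generator, whose index is 1 here. *)
Definition linear_quotients (K : fieldType) (n m : nat)
    (u : 'I_m -> 'X_{1..n}) : Prop :=
  forall j : 'I_m, (0 < j)%N ->
    exists V : {set 'I_n},
      forall p : {mpoly K[n]},
        colon (monomial_span (fun v => exists2 i : 'I_m, (i < j)%N & v = u i))
              (ideal_span (fun q => q = 'X_[K, u j])) p
        <-> ideal_span (fun q => exists2 i, i \in V & q = 'X_i) p.

Section Borel.
Variables (K : fieldType) (n k : nat).
Implicit Types (I : {mpoly K[n]} -> Prop) (u v : 'X_{1..n}).

Definition supp u : {set 'I_n} := [set i | (0 < u i)%N].

Definition k_bounded u : Prop := forall i, (u i <= k)%N.

Definition k_bounded_ideal I : Prop :=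
  exists A, (forall u, A u -> k_bounded u) /\ generated_by I A.

(* x_i (u / x_j); only used for j in supp u, where the truncated subtraction
   of exponents is exact. *)
Definition exchange (i j : 'I_n) u : 'X_{1..n} := (U_(i) + (u - U_(j)))%MM.

Definition k_Borel I : Prop :=
  k_bounded_ideal I /\
  forall u, k_bounded u -> I 'X_[K, u] ->
    forall j i : 'I_n, j \in supp u -> (i < j)%N ->
      k_bounded (exchange i j u) -> I 'X_[K, exchange i j u].

(* The smallest k-Borel ideal containing u: for k-bounded u, the intersection
   of all k-Borel ideals containing u is again k-Borel, since a monomial w lies
   in a k-bounded monomial ideal iff the monomial with exponents min(w_i, k)
   does. *)
Definition B u : {mpoly K[n]} -> Prop :=
  fun p => forall I, k_Borel I -> I 'X_[K, u] -> I p.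

Definition k_preceq v u : Prop :=
  [/\ k_bounded v, k_bounded u, mdeg v = mdeg u & B u 'X_[K, v]].

Definition k_prec v u : Prop := k_preceq v u /\ v <> u.

End Borel.

(* Main.v *)
Require Import Defs.
From mathcomp Require Import zify.

Set Implicit Arguments.
Unset Strict Implicit.
Unset Printing Implicit Defensive.

Import GRing.Theory.
Local Open Scope ring_scope.

(** Let [u] and [v] be two generators, [u] earlier than [v]; both are
    k-bounded and of the common degree [d].  An earlier generator that divides
    the product of [v] by a variable puts this variable in the colon ideal of [v],
    so the point is that any monomial [w] with [u] dividing [w v] is divisible
    by such a variable.

    Since [u] comes earlier, [v] does not precede [u] in the k-Borel order,
    hence there are indices [p < q] with [v_p < u_p] and [u_q < v_q]: if
    instead every index where [v] exceeds [u] were smaller than every index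
    where [u] exceeds [v], then Borel exchanges applied to [u] could bring it
    to [v] one unit at a time, never exceeding the bound [k], so that [v] would
    lie in [B_k(u)] ([k_Borel_reach]).  Now [x_p (v / x_q)] is k-bounded because
    [v_p < u_p <= k]; it lies in [I], has degree [d], is therefore a generator,
    and it strictly precedes [v]; so [x_p] lies in the colon ideal.  Finally
    [u_p > v_p] and the divisibility of [w v] by [u] force [x_p] to divide [w].

    The passage from polynomials to monomials rests on [monomial_spanP]: a
    polynomial belongs to a monomial ideal iff every monomial of its support is
    divisible by a generator. *)

(** * Monomial ideals and their minimal generators *)

Section MonomialIdeals.
Variables (K : fieldType) (n : nat).
Implicit Types (I : {mpoly K[n]} -> Prop) (A : 'X_{1..n} -> Prop).
Implicit Types (p q : {mpoly K[n]}) (a b u v w : 'X_{1..n}).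

Lemma ideal_span_ideal (P : {mpoly K[n]} -> Prop) : is_ideal (ideal_span P).
Proof.
split=> [J [J0 _ _] _ //|p q hp hq J hJ hP|a p hp J hJ hP].
  by have [_ JD _] := hJ; apply: JD; [apply: hp | apply: hq].
by have [_ _ JM] := hJ; apply: JM; apply: hp.
Qed.

Lemma monomial_spanP A p :
  monomial_span A p <->
  (forall w, w \in msupp p -> exists2 a, A a & (a <= w)%MM).
Proof.
split=> [hp|hp].
  apply: (hp (fun p => forall w, w \in msupp p ->
                exists2 a, A a & (a <= w)%MM)) => [|q [a Aa ->] w].
    split=> [w|p1 p2 h1 h2 w|a q hq w]; first by rewrite msupp0.
      by move=> /msuppD_le; rewrite mem_cat => /orP[/h1|/h2].
    case/msuppM_le/allpairsP=> -[w1 w2] /= [_ /hq[b Ab le_b] ->].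
    exists b => //; apply/mnm_lepP => i; rewrite mnmDE.
    by move/mnm_lepP/(_ i): le_b; lia.
  by rewrite msuppX inE => /eqP->; exists a => //; apply/mnm_lepP.
have [S0 SD SM] := ideal_span_ideal (fun q => exists2 a, A a & q = 'X_[K, a]).
rewrite /monomial_span (mpolyE p) big_seq.
apply: big_ind => // w /hp[a Aa le_a].
rewrite -(submK le_a) mpolyXD scalerAl; apply: SM => J _; apply.
by exists a.
Qed.

Lemma monomial_spanXP A w :
  monomial_span A 'X_[K, w] <-> exists2 a, A a & (a <= w)%MM.
Proof.
rewrite monomial_spanP; split=> [|[a Aa le_a] v]; last first.
  by rewrite msuppX inE => /eqP->; exists a.
by apply; rewrite msuppX inE.
Qed.

Lemma generated_byXP I A w : generated_by I A ->
  I 'X_[w] <-> exists2 a, A a & (a <= w)%MM.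
Proof. by move=> gA; rewrite gA; apply: monomial_spanXP. Qed.

Lemma generated_by_gen I A a : generated_by I A -> A a -> I 'X_[a].
Proof.
by move=> gA Aa; apply/(generated_byXP _ gA); exists a => //; apply/mnm_lepP.
Qed.

Lemma lem_trans v u w : (u <= v)%MM -> (v <= w)%MM -> (u <= w)%MM.
Proof.
move=> /mnm_lepP uv /mnm_lepP vw.
by apply/mnm_lepP=> i; apply: leq_trans (vw i).
Qed.

Lemma lem_mdeg_eq u v : (u <= v)%MM -> mdeg u = mdeg v -> u = v.
Proof.
move=> le_uv; rewrite -{1 2}(submK le_uv) mdegD => e.
have /eqP : mdeg (v - u)%MM = 0%N by lia.
by rewrite mdeg_eq0 => /eqP->; rewrite add0m.
Qed.

(** Minimal generators form an antichain for divisibility. *)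
Lemma minimal_generators_antichain I A a b : minimal_generators I A ->
  A a -> A b -> (a <= b)%MM -> a = b.
Proof.
move=> [gA minA] Aa Ab le_ab; have [//|/eqP ne_ab] := eqVneq a b.
have [] // : A b /\ b <> b.
apply: (minA (fun v => A v /\ v <> b)) => [v []//|p|//].
rewrite gA !monomial_spanP; split=> h w /h[c]; last by case=> Ac _; exists c.
have [->|/eqP ne_cb] := eqVneq c b; last by exists c.
by move=> _ /(lem_trans le_ab); exists a.
Qed.

(** G(I) is contained in every monomial generating set of [I]. *)
Lemma minimal_generators_sub I A A' u : minimal_generators I A ->
  generated_by I A' -> A u -> A' u.
Proof.
move=> mA gA' Au; have gA := mA.1.
have /(generated_byXP _ gA')[a A'a le_au] := generated_by_gen gA Au.
have /(generated_byXP _ gA)[b Ab le_ba] := generated_by_gen gA' A'a.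
have eq_bu := minimal_generators_antichain mA Ab Au (lem_trans le_ba le_au).
suff -> : u = a by [].
apply/mnmP=> i; apply/eqP.
by rewrite eqn_leq (mnm_lepP le_au) -eq_bu (mnm_lepP le_ba).
Qed.

Lemma ideal_span_var (V : {set 'I_n}) p :
  ideal_span (fun q => exists2 i, i \in V & q = 'X_i) p <->
  (forall w, w \in msupp p -> exists2 i, i \in V & (0 < w i)%N).
Proof.
have -> : ideal_span (fun q => exists2 i, i \in V & q = 'X_i) p <->
    monomial_span (fun v => exists2 i, i \in V & v = U_(i)%MM) p.
  split=> hp J hJ hV; apply: hp => // q.
    by case=> i Vi ->; apply: hV; exists U_(i)%MM => //; exists i.
  by case=> v [i Vi ->] ->; apply: hV; exists i.
rewrite monomial_spanP; split=> h w /h.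
  case=> _ [i Vi ->] /mnm_lepP/(_ i); rewrite mnm1E eqxx => w_gt0.
  by exists i.
case=> i Vi w_gt0; exists U_(i)%MM; first by exists i.
by apply/mnm_lepP=> l; rewrite mnm1E; case: eqP => [<-|].
Qed.

Lemma colon_monomialP A u p :
  colon (monomial_span A) (ideal_span (fun q => q = 'X_[K, u])) p <->
  (forall w, w \in msupp p -> exists2 a, A a & (a <= u + w)%MM).
Proof.
have [S0 SD SM] := ideal_span_ideal (fun q => exists2 a, A a & q = 'X_[K, a]).
have -> : colon (monomial_span A) (ideal_span (fun q => q = 'X_[K, u])) p <->
    monomial_span A (p * 'X_[u]).
  split=> [|hp q]; first by apply=> J _; apply.
  move/(_ (fun q => monomial_span A (p * q))); apply; last by move=> _ ->.
  split=> [|q1 q2|a q1]; first by rewrite mulr0.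
    by rewrite mulrDr; apply: SD.
  by rewrite mulrCA; apply: SM.
rewrite monomial_spanP; split=> h w.
  by move=> w_p; apply: h; rewrite (perm_mem (msuppMX _ _)); apply: map_f.
by rewrite (perm_mem (msuppMX _ _)) => /mapP[v v_p ->]; apply: h.
Qed.

End MonomialIdeals.

(** * Borel exchanges and the k-Borel order *)

Section BorelExchange.
Variables (n k : nat).
Implicit Types (u v : 'X_{1..n}) (i j l p q : 'I_n).

Lemma exchangeE i j u l :
  exchange i j u l = ((i == l) + (u l - (j == l)))%N.
Proof. by rewrite /exchange mnmDE mnmBE !mnm1E. Qed.

Lemma mdeg_exchange i j u : j \in supp u -> mdeg (exchange i j u) = mdeg u.
Proof.
rewrite inE => u_j; have le_ju : (U_(j) <= u)%MM.
  by apply/mnm_lepP=> l; rewrite mnm1E; case: eqP => [<-|].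
by rewrite /exchange mdegD mdeg1 -{2}(submK le_ju) mdegD mdeg1 addnC.
Qed.

(** An exchange preserves k-boundedness as soon as the exponent that grows
    stays below another k-bounded monomial. *)
Lemma k_bounded_exchange i j u v : k_bounded k u -> k_bounded k v ->
  (u i < v i)%N -> k_bounded k (exchange i j u).
Proof.
move=> bu bv lt_i l; rewrite exchangeE.
by have [<-|] := eqVneq i l; [have := bv i; lia | have := bu l; lia].
Qed.

Lemma mdeg_eq_excess u v : mdeg u = mdeg v -> u <> v -> exists p, (v p < u p)%N.
Proof.
move=> e_deg ne_uv; apply/existsP; apply: contra_notT ne_uv.
rewrite negb_exists => /forallP le_uv; apply: lem_mdeg_eq => //.
by apply/mnm_lepP=> i; rewrite leqNgt.
Qed.

(** If every index where [v] exceeds [u] is smaller than every index where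
    [u] exceeds [v], then [v] lies in every k-Borel ideal that contains
    [u]. *)
Lemma k_Borel_reach (K : fieldType) (J : {mpoly K[n]} -> Prop) u v :
  k_Borel k J -> k_bounded k u -> k_bounded k v -> mdeg u = mdeg v ->
  (forall p q, (v p < u p)%N -> (u q < v q)%N -> (q < p)%N) ->
  J 'X_[u] -> J 'X_[v].
Proof.
move=> [_ stepJ] + bv.
have [N] := ubnP (\sum_i (u i - v i)); elim: N u => // N IHN u.
move=> leN bu e_deg noinv Ju.
have [<- //|/eqP ne_uv] := eqVneq u v.
have [p lt_p] := mdeg_eq_excess e_deg ne_uv.
have [q lt_q] := mdeg_eq_excess (esym e_deg) (not_eq_sym ne_uv).
have lt_qp := noinv p q lt_p lt_q.
have ne_qp : q != p by rewrite -val_eqE neq_ltn lt_qp.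
have u_p : p \in supp u by rewrite inE; lia.
have bx := k_bounded_exchange p bu bv lt_q.
apply: (IHN (exchange q p u)) => //.
- apply: leq_trans (_ : (\sum_i (u i - v i) <= N)%N); last by lia.
  (* The excess drops at [p] and is unchanged elsewhere, being 0 at [q]. *)
  rewrite (bigD1 p) // [X in (_ < X)%N](bigD1 p) //= -addSn leq_add //.
    by rewrite exchangeE eqxx (negbTE ne_qp); lia.
  by apply: leq_sum => l; rewrite exchangeE; have [<-|] := eqVneq q l; lia.
- by rewrite mdeg_exchange.
- move=> i l; rewrite !exchangeE => hi hl; apply: noinv; move: hi hl.
    by have [<-|] := eqVneq q i; lia.
  by move=> _; have [<-|] := eqVneq p l; lia.
- exact: stepJ.
Qed.

Lemma k_prec_exchange (K : fieldType) i j u : k_bounded k u ->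
  k_bounded k (exchange i j u) -> j \in supp u -> (i < j)%N ->
  k_prec K k (exchange i j u) u.
Proof.
move=> bu bx u_j lt_ij; split; first split=> //.
- exact: mdeg_exchange.
- by move=> J [_ stepJ] Ju; apply: stepJ.
- move/mnmP/(_ i); rewrite exchangeE eqxx -val_eqE /= gtn_eqF //; lia.
Qed.

(** The contrapositive of [k_Borel_reach], in the form that yields an exchange
    of [v] increasing its [p]-th exponent. *)
Lemma not_k_prec_inversion (K : fieldType) u v : k_bounded k u ->
  k_bounded k v -> mdeg u = mdeg v -> v <> u -> ~ k_prec K k v u ->
  exists p q : 'I_n, [/\ (p < q)%N, (v p < u p)%N & (u q < v q)%N].
Proof.
move=> bu bv e_deg ne_vu nprec.
have [/existsP[p /existsP[q /and3P[]]]|noinv] :=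
  boolP [exists p : 'I_n, exists q : 'I_n,
                  [&& (p < q)%N, (v p < u p)%N & (u q < v q)%N]].
  by exists p, q.
case: nprec; split=> //; split=> // J BJ.
apply: k_Borel_reach => // p q lt_p lt_q.
rewrite ltnNge leq_eqVlt; apply: contra noinv => /orP[/eqP/val_inj e_pq|lt_pq].
  by move: lt_p lt_q; rewrite e_pq; lia.
by apply/existsP; exists p; apply/existsP; exists q; rewrite lt_pq lt_p.
Qed.

End BorelExchange.

(** * Linear quotients *)

Theorem corollary2p5 (K : fieldType) (n k : nat) (I : {mpoly K[n]} -> Prop)
    (m : nat) (u : 'I_m -> 'X_{1..n}) :
  (1 <= k)%N ->
  k_Borel k I ->
  generated_in_single_degree I ->
  enumerates_generators I u ->
  (forall i j : 'I_m, k_prec K k (u i) (u j) -> (i < j)%N) ->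
  linear_quotients K u.
Proof.
move=> _ [[A [bA gA]] stepI] [d [D [degD gD]]] [inj_u minI] ext_u j _.
have bu i : k_bounded k (u i).
  by apply: bA; apply: (minimal_generators_sub minI gA); exists i.
have degu i : mdeg (u i) = d.
  by apply: degD; apply: (minimal_generators_sub minI gD); exists i.
(* The variables whose product with [u j] is divisible by an earlier
   generator. *)
exists [set t | [exists i : 'I_m, (i < j)%N && (u i <= U_(t) + u j)%MM]] => p.
rewrite colon_monomialP ideal_span_var; split=> h w /h; last first.
  case=> t; rewrite inE => /existsP[i /andP[lt_ij /mnm_lepP le_i]] w_t.
  exists (u i); first by exists i.
  apply/mnm_lepP=> l; move: (le_i l); rewrite !mnmDE mnm1E.
  by case: eqP => [<-|]; lia.
case=> _ [i lt_ij ->] /mnm_lepP le_i.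
have ne_ji : u j <> u i by move/inj_u=> e; rewrite e ltnn in lt_ij.
have nprec : ~ k_prec K k (u j) (u i) by move/ext_u; lia.
have e_deg : mdeg (u i) = mdeg (u j) by rewrite !degu.
have [s [t [lt_st lt_s lt_t]]] :=
  not_k_prec_inversion (bu i) (bu j) e_deg ne_ji nprec.
have u_t : t \in supp (u j) by rewrite inE; lia.
have bx := k_bounded_exchange t (bu j) (bu i) lt_s.
have Iuj : I 'X_[u j] by apply: (generated_by_gen minI.1); exists j.
have Ix := stepI _ (bu j) Iuj _ _ u_t lt_st bx.
(* The exchanged monomial has the degree of the generators, so a generator
   dividing it must be equal to it. *)
have /(generated_byXP _ minI.1)[_ [l ->] le_l] := Ix.
have e_l : u l = exchange s t (u j).
  by apply: lem_mdeg_eq => //; rewrite mdeg_exchange // !degu.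
have lt_lj : (l < j)%N by apply: ext_u; rewrite e_l; apply: k_prec_exchange.
exists s; last by have := le_i s; rewrite mnmDE; lia.
rewrite inE; apply/existsP; exists l; rewrite lt_lj e_l.
by apply/mnm_lepP=> r; rewrite exchangeE mnmDE mnm1E; lia.
Qed.
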